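(* Let $n\ge 2$ be an integer. For $k\in\{1,2\}$ let $$B_n^{(k)}=\left\{\rho\in\mathbb{C}:\ \rho=f_n^{(k)}(u)\ \text{for some } u\in[-\pi,\pi]\right\}.$$ Then $B_n^{(1)}$ and $B_n^{(2)}$ are closed curves; $K_n(\rho)$ possesses a borderline type-1 eigenvalue if and only if $\rho\in B_n^{(1)}$; and $K_n(\rho)$ possesses a borderline type-2 eigenvalue if and only if $\rho\in B_n^{(2)}$.
   Context: For an integer $n\ge 2$ and $\rho\in\mathbb{C}$, $K_n(\rho)=[\rho^{|j-k|}]_{j,k=1}^n$ (with ones on the diagonal, also when $\rho=0$). An eigenvalue $\lambda$ of $K_n(\rho)$ is borderline if $|\lambda|=n$. A vector $y\in\mathbb{C}^n$ is symmetric if $y_{n+1-j}=y_j$ for all $j$, and skew-symmetric if $y_{n+1-j}=-y_j$ for all $j$. An eigenvalue of $K_n(\rho)$ is of type-1 if it has a nonzero skew-symmetric eigenvector, and of type-2 if it has a nonzero symmetric eigenvector. For $u\in[-\pi,\pi]$ let $g_n(u)=n^2\sin^2u-\sin^2(nu)$, let $v(n,u)$ be the unique root $v\ge 0$ of $\sinh^2(nv)-n^2\sinh^2v=g_n(u)$, let $\mu(n,u)=u+i\,v(n,u)$, and let $$f_n^{(1)}(u)=\frac{\sin\frac{(n+1)\mu(n,u)}{2}}{\sin\frac{(n-1)\mu(n,u)}{2}},\qquad f_n^{(2)}(u)=\frac{\cos\frac{(n+1)\mu(n,u)}{2}}{\cos\frac{(n-1)\mu(n,u)}{2}},$$ where quotients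 $0/0$ (possible only at $u=0,\pm\pi$) are understood as removable singularities in $\mu$, i.e. by their limiting values. ''Closed curve'' means that $f_n^{(k)}$ is continuous on $[-\pi,\pi]$ with $f_n^{(k)}(-\pi)=f_n^{(k)}(\pi)$. *)

(* Defs.v *)
From HB Require Import structures.
From mathcomp Require Import all_boot all_order all_algebra.
From mathcomp Require Import all_classical all_reals all_analysis.
From mathcomp Require Import complex.

Set Implicit Arguments.
Unset Strict Implicit.
Unset Printing Implicit Defensive.

Import Order.TTheory GRing.Theory Num.Theory.
Import numFieldNormedType.Exports.

Local Open Scope classical_set_scope.
Local Open Scope ring_scope.
Local Open Scope complex_scope.

Section Kac_Murdock_Szego.
Variable R : realType.

(* x ^+ 0 = 1 also for x = 0, so the diagonal is always 1. *)
Definition KMS (n : nat) (rho : R[i]) : 'M[R[i]]_n :=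
  \matrix_(j, k) rho ^+ `|(j : int) - (k : int)|%N.

(* rev_ord j is the 0-based counterpart of n + 1 - j. *)
Definition symmetric_vec (n : nat) (y : 'cV[R[i]]_n) : Prop :=
  forall j : 'I_n, y (rev_ord j) 0 = y j 0.

Definition skew_symmetric_vec (n : nat) (y : 'cV[R[i]]_n) : Prop :=
  forall j : 'I_n, y (rev_ord j) 0 = - y j 0.

Definition eigenvector (n : nat) (A : 'M[R[i]]_n) (lam : R[i])
    (y : 'cV[R[i]]_n) : Prop :=
  y != 0 /\ A *m y = lam *: y.

Definition type1_eigenvalue (n : nat) (rho lam : R[i]) : Prop :=
  eigenvalue (KMS n rho) lam /\
  exists y : 'cV[R[i]]_n, skew_symmetric_vec y /\ eigenvector (KMS n rho) lam y.

Definition type2_eigenvalue (n : nat) (rho lam : R[i]) : Prop :=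
  eigenvalue (KMS n rho) lam /\
  exists y : 'cV[R[i]]_n, symmetric_vec y /\ eigenvector (KMS n rho) lam y.

Definition borderline_eigenvalue (n : nat) (rho lam : R[i]) : Prop :=
  eigenvalue (KMS n rho) lam /\ `|lam| = n%:R.

Definition sinh (x : R) : R := (expR x - expR (- x)) / 2.

Definition cexp (z : R[i]) : R[i] :=
  (expR (complex.Re z))%:C * (cos (complex.Im z) +i* sin (complex.Im z)).

Definition csin (z : R[i]) : R[i] :=
  (cexp ('i%C * z) - cexp (- ('i%C * z))) / (2 * 'i%C).

Definition ccos (z : R[i]) : R[i] := (cexp ('i%C * z) + cexp (- ('i%C * z))) / 2.

Definition g (n : nat) (u : R) : R :=
  n%:R ^+ 2 * sin u ^+ 2 - sin (n%:R * u) ^+ 2.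

(* The chosen root; it exists and is unique for n >= 2, so that the default
   value 0 of xget is not used. *)
Definition v (n : nat) (u : R) : R :=
  xget 0 [set t : R | 0 <= t /\
    sinh (n%:R * t) ^+ 2 - n%:R ^+ 2 * sinh t ^+ 2 = g n u].

Definition mu (n : nat) (u : R) : R[i] := u +i* v n u.

(* The quotient p / q at z, where a quotient 0 / 0 is replaced by the limit of
   p w / q w as the complex variable w tends to z, w != z. R[i] carries its norm
   topology through the alias R[i]^o. *)
Definition quotient_ext (p q : R[i]^o -> R[i]^o) (z : R[i]^o) : R[i]^o :=
  if (p z == 0) && (q z == 0) then lim (p w / q w @[w --> z^']) else p z / q z.

Definition f1 (n : nat) (u : R) : R[i]^o :=
  quotient_ext (fun w => csin ((n%:R + 1) * w / 2))
               (fun w => csin ((n%:R - 1) * w / 2)) (mu n u).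

Definition f2 (n : nat) (u : R) : R[i]^o :=
  quotient_ext (fun w => ccos ((n%:R + 1) * w / 2))
               (fun w => ccos ((n%:R - 1) * w / 2)) (mu n u).

Definition B1 (n : nat) : set R[i] :=
  [set rho | exists2 u : R, u \in `[- pi, pi] & rho = f1 n u].

Definition B2 (n : nat) : set R[i] :=
  [set rho | exists2 u : R, u \in `[- pi, pi] & rho = f2 n u].

Definition closed_curve (f : R -> R[i]^o) : Prop :=
  {within `[- pi, pi], continuous f} /\ f (- pi) = f pi.

End Kac_Murdock_Szego.

(* Main.v *)
Require Import Defs.
From mathcomp Require Import all_boot all_order all_algebra.
From mathcomp Require Import all_classical all_reals all_analysis.
From mathcomp Require Import complex zify ring lra.

Set Implicit Arguments.
Unset Strict Implicit.
Unset Printing Implicit Defensive.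

Import Order.TTheory GRing.Theory Num.Theory.
Import numFieldNormedType.Exports.

Local Open Scope classical_set_scope.
Local Open Scope ring_scope.
Local Open Scope complex_scope.

(** The matrix K = K_n(rho) satisfies T K = (1 - rho^2) I, where T is
    tridiagonal with diagonal 1, 1 + rho^2, ..., 1 + rho^2, 1 and off-diagonal
    entries - rho.  Hence an eigenvector y of K for a nonzero lam satisfies
    T y = kappa y with lam kappa = 1 - rho^2: a three-term recurrence
    y_(j-1) + y_(j+1) = 2 c y_j with constant coefficients, the boundary rows
    saying that y continues to a sequence with y_(-1) = rho y_0.  Write
    c = cos z.  The recurrence is also solved by the sequence
    S((n + 1 - 2 j) z / 2), j = 0, ..., n + 1, of the same parity as y, where
    S = sin for skew-symmetric and S = cos for symmetric vectors.  The
    Casoratian of the two sequences is constant by the recurrence and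
    antisymmetric by parity, so it vanishes, which gives
      rho S((n - 1) z / 2) = S((n + 1) z / 2)
    ([eigenvector_secular]).  Conversely this relation makes the trigonometric
    sequence an eigenvector ([ksum_telescope]).

    If sin z is not 0, two trigonometric identities ([kappa_identity],
    [det_identity]) yield lam = -sin (n z) / sin z in the skew-symmetric and
    lam = sin (n z) / sin z in the symmetric case.  So lam is borderline iff
    |sin (n z)|^2 = n^2 |sin z|^2.  Since |sin (x + i y)|^2 = sin^2 x + sinh^2 y,
    this is the equation defining v(n, x) when y >= 0, i.e. it says that
    z = mu(n, x).  The normalisation -pi <= Re z <= pi and Im z >= 0 is possible
    as cos is even, 2 pi-periodic and onto the complex plane ([ccos_surj]).

    If sin z = 0, then z is real, z = mu(n, z), and either
    S((n - 1) z / 2) is not 0, rho = cos z and K has rank one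
    ([ksum_rank1]), or numerator and denominator both vanish.  In the latter
    case the z-derivative of the trigonometric sequence takes its place: it
    solves the same recurrence because sin z = 0, has the same parity, and
    gives rho = cos z (n + 1) / (n - 1), the limit of the quotient
    ([curve_singular]), with lam = - n.

    For continuity, the defining function of v is strictly increasing on
    [0, +oo), so v is continuous ([continuous_v]).  The quotient is continuous
    where its denominator is not 0.  Its denominator vanishes at mu(n, u) only
    if v(n, u) = 0, hence sin u = 0; there it has a removable singularity.  At
    u = pi and u = -pi the values agree because the value at a zero of sin only
    depends on cos and on whether the denominator vanishes ([curve_real]). *)

(** * Complex trigonometric functions *)

Section Trig.
Variable R : realType.
Implicit Types (x y t : R) (w z : R[i]).

Lemma cexpD w z : cexp (w + z) = cexp w * cexp z.
Proof.
case: w z => [a b] [c d]; rewrite /cexp /= expRD cosD sinD.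
by apply/eqP; rewrite eq_complex /=; apply/andP; split; apply/eqP; ring.
Qed.

Lemma cexp0 : cexp 0 = 1 :> R[i].
Proof. by rewrite /cexp /= expR0 cos0 sin0 mul1r. Qed.

Lemma cexp_neq0 w : cexp w != 0.
Proof.
apply/eqP => e; have := cexpD w (- w).
by rewrite subrr cexp0 e mul0r => /eqP; rewrite oner_eq0.
Qed.

Lemma cexpN w : cexp (- w) = (cexp w)^-1.
Proof.
by apply: (mulfI (cexp_neq0 w)); rewrite -cexpD subrr cexp0 divff ?cexp_neq0.
Qed.

Lemma imunit_sq : 'i%C * 'i%C = -1 :> R[i].
Proof. by rewrite -expr2 sqr_i. Qed.

Lemma imunit_neq0 : 'i%C != 0 :> R[i].
Proof. by rewrite eq_complex /= oner_eq0 andbF. Qed.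

(** The quotient by 2 i is turned into a product so that addition formulas become
    ring identities in exp (i w) and its inverse. *)
Lemma csinE z : csin z = - ('i%C / 2) * (cexp ('i%C * z) - (cexp ('i%C * z))^-1).
Proof.
rewrite /csin cexpN.
have -> : (2 * 'i%C)^-1 = - ('i%C / 2) :> R[i].
  apply: (@mulfI _ (2 * 'i%C)); first by rewrite mulf_neq0 ?imunit_neq0 ?pnatr_eq0.
  rewrite divff ?mulf_neq0 ?imunit_neq0 ?pnatr_eq0 //.
  have := imunit_sq; set i := 'i%C => hi.
  have -> : 2 * i * - (i / 2) = - (i * i) * (2 / 2) by ring.
  by rewrite hi divff ?pnatr_eq0 //; ring.
by rewrite mulrC.
Qed.

Lemma ccosE z : ccos z = (cexp ('i%C * z) + (cexp ('i%C * z))^-1) / 2.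
Proof. by rewrite /ccos cexpN. Qed.

Lemma csinD w z : csin (w + z) = csin w * ccos z + ccos w * csin z.
Proof.
rewrite !csinE !ccosE (mulrDr 'i%C) cexpD.
have := cexp_neq0 ('i%C * w); have := cexp_neq0 ('i%C * z).
move: (cexp _) (cexp _) => a b a0 b0; field; exact/andP.
Qed.

Lemma ccosD w z : ccos (w + z) = ccos w * ccos z - csin w * csin z.
Proof.
rewrite !csinE !ccosE (mulrDr 'i%C) cexpD.
have := cexp_neq0 ('i%C * w); have := cexp_neq0 ('i%C * z).
move: (cexp _) (cexp _) => a b a0 b0.
have := imunit_sq; move: ('i%C : R[i]) => i hi.
transitivity ((b + b^-1) / 2 * ((a + a^-1) / 2) -
  (i * i) * ((b - b^-1) / 2 * ((a - a^-1) / 2))); last by ring.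
by rewrite hi; field; exact/andP.
Qed.

Lemma csinN w : csin (- w) = - csin w.
Proof. by rewrite !csinE mulrN cexpN invrK; ring. Qed.

Lemma ccosN w : ccos (- w) = ccos w.
Proof. by rewrite !ccosE mulrN cexpN invrK addrC. Qed.

Lemma csin0 : csin 0 = 0 :> R[i].
Proof. by rewrite csinE mulr0 cexp0 invr1 subrr mulr0. Qed.

Lemma ccos0 : ccos 0 = 1 :> R[i].
Proof. by rewrite ccosE mulr0 cexp0 invr1 divff // pnatr_eq0. Qed.

Lemma ccos2Dcsin2 w : ccos w ^+ 2 + csin w ^+ 2 = 1.
Proof. by rewrite -ccos0 -(subrr w) ccosD ccosN csinN; ring. Qed.

Definition cosh x : R := (expR x + expR (- x)) / 2.

Lemma cosh2Bsinh2 x : cosh x ^+ 2 - sinh x ^+ 2 = 1.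
Proof.
rewrite /cosh /sinh expRN; have := expR_gt0 x; move: (expR x) => a a0.
by field; rewrite gt_eqF.
Qed.

Lemma sinhD x y : sinh (x + y) = sinh x * cosh y + cosh x * sinh y.
Proof.
rewrite /cosh /sinh !expRN expRD.
have := expR_gt0 x; have := expR_gt0 y; move: (expR x) (expR y) => a b a0 b0.
by field; rewrite !gt_eqF.
Qed.

Lemma csin_rect x y : csin (x +i* y) = (sin x * cosh y) +i* (cos x * sinh y).
Proof.
rewrite /csin /cexp.
have -> : 'i%C * (x +i* y) = (- y) +i* x by simpc.
rewrite /= sinN cosN opprK /cosh /sinh.
apply: (@mulIf _ (2 * 'i%C)); first by rewrite mulf_neq0 ?imunit_neq0 ?pnatr_eq0.
rewrite divfK ?mulf_neq0 ?imunit_neq0 ?pnatr_eq0 //.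
have -> : 2 * 'i%C = (0 +i* 2) :> R[i].
  by apply/eqP; rewrite eq_complex /=; apply/andP; split; apply/eqP; ring.
by apply/eqP; rewrite eq_complex /=; apply/andP; split; apply/eqP; field.
Qed.

Lemma ccos_rect x y : ccos (x +i* y) = (cos x * cosh y) +i* - (sin x * sinh y).
Proof.
rewrite /ccos /cexp.
have -> : 'i%C * (x +i* y) = (- y) +i* x by simpc.
rewrite /= sinN cosN opprK /cosh /sinh.
apply: (@mulIf _ 2); first by rewrite pnatr_eq0.
rewrite divfK ?pnatr_eq0 //.
have -> : 2 = (2 +i* 0) :> R[i].
  by apply/eqP; rewrite eq_complex /=; apply/andP; split; apply/eqP; ring.
by apply/eqP; rewrite eq_complex /=; apply/andP; split; apply/eqP; field.
Qed.

Lemma sqr_norm_csin x y : `|csin (x +i* y)| ^+ 2 = (sin x ^+ 2 + sinh y ^+ 2)%:C.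
Proof.
rewrite -add_Re2_Im2 csin_rect /=; congr _%:C.
have := cosh2Bsinh2 y; have := cos2Dsin2 x.
move: (cos x) (sin x) (cosh y) (sinh y) => c s C S h1 h2.
rewrite !exprMn; have -> : C ^+ 2 = 1 + S ^+ 2 by rewrite -h2; ring.
have -> : c ^+ 2 = 1 - s ^+ 2 by rewrite -h1; ring.
ring.
Qed.

Lemma sqr_norm_ccos x y : `|ccos (x +i* y)| ^+ 2 = (cos x ^+ 2 + sinh y ^+ 2)%:C.
Proof.
rewrite -add_Re2_Im2 ccos_rect /=; congr _%:C.
have := cosh2Bsinh2 y; have := cos2Dsin2 x.
move: (cos x) (sin x) (cosh y) (sinh y) => c s C S h1 h2.
rewrite sqrrN !exprMn; have -> : C ^+ 2 = 1 + S ^+ 2 by rewrite -h2; ring.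
have -> : s ^+ 2 = 1 - c ^+ 2 by rewrite -h1; ring.
ring.
Qed.

(** The two types are treated together: [true] stands for skew-symmetric vectors
    and the sine, [false] for symmetric vectors and the cosine.  [tau b] is the
    parity sign of [trig b], and [dtrig b] its derivative. *)
Definition tau (b : bool) : R[i] := if b then -1 else 1.
Definition trig (b : bool) z := if b then csin z else ccos z.
Definition dtrig (b : bool) z := if b then ccos z else - csin z.

Lemma tau_sq b : tau b * tau b = 1.
Proof. by case: b; rewrite /tau ?mulrNN mulr1. Qed.

Lemma norm_tau b : `|tau b| = 1.
Proof. by case: b; rewrite /tau ?normrN normr1. Qed.

Lemma trigD b w z : trig b (w + z) = trig b w * ccos z + dtrig b w * csin z.
Proof. by case: b; rewrite /trig /dtrig ?csinD ?ccosD ?mulNr. Qed.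

Lemma dtrigD b w z : dtrig b (w + z) = dtrig b w * ccos z - trig b w * csin z.
Proof. by case: b; rewrite /trig /dtrig ?csinD ?ccosD //; ring. Qed.

Lemma trigN b w : trig b (- w) = tau b * trig b w.
Proof. by case: b; rewrite /trig /tau ?csinN ?ccosN ?mulN1r ?mul1r. Qed.

Lemma dtrigN b w : dtrig b (- w) = - tau b * dtrig b w.
Proof. by case: b; rewrite /dtrig /tau ?csinN ?ccosN ?mulN1r ?opprK ?mul1r. Qed.

Lemma trig2Ddtrig2 b w : trig b w ^+ 2 + dtrig b w ^+ 2 = 1.
Proof. by rewrite -(ccos2Dcsin2 w); case: b; rewrite /trig /dtrig ?sqrrN // addrC. Qed.

Lemma real_sqr_eq0 x y : x ^+ 2 + y ^+ 2 = 0 -> x = 0 /\ y = 0.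
Proof.
move=> /eqP; rewrite paddr_eq0 ?sqr_ge0 // !sqrf_eq0 => /andP[/eqP -> /eqP ->].
by [].
Qed.

Lemma sinh_eq0 y : sinh y = 0 -> y = 0.
Proof.
rewrite /sinh => /eqP; rewrite mulf_eq0 invr_eq0 pnatr_eq0 orbF subr_eq0 => /eqP.
by move=> /expR_inj h; lra.
Qed.

Lemma csin_eq0 x y : csin (x +i* y) = 0 -> sin x = 0 /\ y = 0.
Proof.
move=> e; have := sqr_norm_csin x y; rewrite e normr0 expr0n /= => /esym /complexI.
by move=> /real_sqr_eq0[-> /sinh_eq0].
Qed.

(** By the two modulus formulas, a zero off the real axis would make a sum of
    squares with the positive term sinh^2 y vanish. *)
Lemma trig_eq0_Im b x y : trig b (x +i* y) = 0 -> y = 0.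
Proof.
case: b => /= [/csin_eq0[]//|e].
have := sqr_norm_ccos x y; rewrite e normr0 expr0n /= => /esym /complexI.
by move=> /real_sqr_eq0[_ /sinh_eq0].
Qed.

Lemma csin_real x : csin x%:C = (sin x)%:C.
Proof.
by rewrite csin_rect /cosh /sinh oppr0 expR0 subrr mul0r mulr0 (_ : (1 + 1) / 2 = 1) ?mulr1 //; field.
Qed.

Lemma ccos_real x : ccos x%:C = (cos x)%:C.
Proof.
by rewrite ccos_rect /cosh /sinh oppr0 expR0 subrr mul0r mulr0 oppr0 (_ : (1 + 1) / 2 = 1) ?mulr1 //; field.
Qed.

Lemma unit_circle_angle x y : x ^+ 2 + y ^+ 2 = 1 ->
  exists2 t, - pi <= t <= pi & x = cos t /\ y = sin t.
Proof.
move=> h.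
have hx : -1 <= x <= 1 by have := sqr_ge0 y => hy; apply/andP; split; nra.
have cx : cos (acos x) = x by apply: acosK; rewrite in_itv.
have sx : sin (acos x) = `|y|.
  by rewrite sin_acos // (_ : 1 - x ^+ 2 = y ^+ 2) ?sqrtr_sqr // -h; ring.
have a0 := acos_ge0 hx; have a1 := acos_lepi hx.
have [y0|y0] := leP 0 y.
  exists (acos x); last by rewrite cx sx ger0_norm.
  by rewrite a1 andbT; lra.
exists (- acos x); last by rewrite cosN sinN cx sx ltr0_norm // opprK.
by apply/andP; split; lra.
Qed.

Lemma cexp_surj z : z != 0 ->
  exists w, cexp ('i%C * w) = z /\ - pi <= complex.Re w <= pi.
Proof.
case: z => a b z0; set r := Num.sqrt (a ^+ 2 + b ^+ 2).
have r0 : 0 < r.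
  rewrite sqrtr_gt0 lt_neqAle addr_ge0 ?sqr_ge0 // andbT eq_sym.
  by apply: contra z0 => /eqP /real_sqr_eq0[-> ->].
have rr : r ^+ 2 = a ^+ 2 + b ^+ 2 by rewrite sqr_sqrtr // addr_ge0 ?sqr_ge0.
have [|t ht [ea eb]] := @unit_circle_angle (a / r) (b / r).
  by rewrite !expr_div_n -mulrDl -rr divff // expf_neq0 // gt_eqF.
exists (t +i* - ln r); split => //.
have -> : 'i%C * (t +i* - ln r) = ln r +i* t by simpc; rewrite ?opprK.
rewrite /cexp /= lnK ?posrE // -ea -eb.
apply/eqP; rewrite eq_complex /=; apply/andP; split; apply/eqP; field;
  by rewrite gt_eqF.
Qed.

(** cos z = c is a quadratic equation for exp (i z), whose two roots
    c + s and c - s, s^2 = c^2 - 1, are inverse to each other; replacing z by - z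
    exchanges them and adjusts the sign of the imaginary part. *)
Lemma ccos_surj c :
  exists x y, [/\ ccos (x +i* y) = c, - pi <= x <= pi & 0 <= y].
Proof.
set s := sqrtc (c ^+ 2 - 1); have hs : s ^+ 2 = c ^+ 2 - 1 by rewrite sqr_sqrtc.
have e1 : (c + s) * (c - s) = 1 by rewrite mulrC -subr_sqr hs; ring.
have cs0 : c + s != 0.
  by apply/eqP => e; move: e1; rewrite e mul0r => /eqP; rewrite eq_sym oner_eq0.
have [[x y] [/= hw /andP[x1 x2]]] := cexp_surj cs0.
have hc : ccos (x +i* y) = c.
  rewrite ccosE hw (_ : (c + s)^-1 = c - s).
    by field.
  by apply: (mulfI cs0); rewrite divff.
have [y0|y0] := leP 0 y; first by exists x, y; rewrite x1 x2.
exists (- x), (- y); split; [|by apply/andP; split; lra|lra].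
by rewrite -hc -ccosN; congr ccos; simpc; rewrite ?opprK.
Qed.

End Trig.

(** * Eigenvectors of the matrix and the three-term recurrence *)

Section KacMurdockSzego.
Variable R : realType.
Local Notation C := R[i].
Implicit Types (rho lam c kappa : C).

Lemma KMS_sym n rho : (KMS n rho)^T = KMS n rho.
Proof. by apply/matrixP => i j; rewrite !mxE distnC. Qed.

(** Eigenvalues are defined by row vectors, which makes no difference for a
    symmetric matrix. *)
Lemma eigenvector_eigenvalue n rho lam (y : 'cV[C]_n) :
  eigenvector (KMS n rho) lam y -> eigenvalue (KMS n rho) lam.
Proof.
move=> [y0 h]; apply/eigenvalueP; exists y^T; last by rewrite trmx_eq0.
by rewrite -{1}(KMS_sym n rho) -trmx_mul h linearZ.
Qed.

Lemma KMS_mulE n rho (y : 'cV[C]_n) (W : nat -> C) (j : 'I_n) :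
  (forall k : 'I_n, y k 0 = W k) ->
  (KMS n rho *m y) j 0 = \sum_(0 <= k < n) rho ^+ `|(j : int) - (k : int)|%N * W k.
Proof.
by move=> h; rewrite mxE big_mkord; apply: eq_bigr => k _; rewrite mxE h.
Qed.

Lemma sum_single n (F : nat -> C) j : (j < n)%N ->
  (forall k, k != j -> F k = 0) -> \sum_(0 <= k < n) F k = F j.
Proof.
move=> jn h; rewrite big_mkord (bigD1 (Ordinal jn)) //= big1 ?addr0 // => k kj.
by apply: h; apply: contra kj => /eqP e; apply/eqP/val_inj.
Qed.

(** The product of the matrix with a vector, for sequences indexed by all naturals,
    which makes shifts of the index available. *)
Definition ksum n rho (W : nat -> C) (j : nat) : C :=
  \sum_(0 <= k < n) rho ^+ `|(j : int) - (k : int)|%N * W k.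

(** The interior rows of T K = (1 - rho^2) I.  Off the diagonal, the three
    exponents are d, d + 1, d + 2 in one order or the other, and
    (1 + rho^2) rho^(d+1) = rho (rho^d + rho^(d+2)). *)
Lemma ksum_interior n rho W j : (j.+1 < n)%N ->
  (1 + rho ^+ 2) * ksum n rho W j.+1 - rho * ksum n rho W j
    - rho * ksum n rho W j.+2 = (1 - rho ^+ 2) * W j.+1.
Proof.
move=> jn; rewrite /ksum !mulr_sumr -!sumrB (@sum_single _ _ j.+1) //.
  have -> : `|(j.+1 : int) - (j.+1 : int)|%N = 0%N by lia.
  have -> : `|(j : int) - (j.+1 : int)|%N = 1%N by lia.
  have -> : `|(j.+2 : int) - (j.+1 : int)|%N = 1%N by lia.
  by rewrite expr0 expr1; ring.
move=> k kj; case: (leqP k j) => kj'.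
  have [d ed] : exists d, `|(j : int) - (k : int)|%N = d by eexists.
  have -> : `|(j.+1 : int) - (k : int)|%N = d.+1 by lia.
  have -> : `|(j.+2 : int) - (k : int)|%N = d.+2 by lia.
  by rewrite ed !exprS; ring.
have [d ed] : exists d, `|(j.+2 : int) - (k : int)|%N = d by eexists.
have -> : `|(j.+1 : int) - (k : int)|%N = d.+1 by lia.
have -> : `|(j : int) - (k : int)|%N = d.+2 by lia.
by rewrite ed !exprS; ring.
Qed.

(** The first row of T K = (1 - rho^2) I; for vectors with a
    parity the last row is its mirror image. *)
Lemma ksum_boundary n rho W : (0 < n)%N ->
  ksum n rho W 0 - rho * ksum n rho W 1 = (1 - rho ^+ 2) * W 0%N.
Proof.
move=> jn; rewrite /ksum !mulr_sumr -!sumrB (@sum_single _ _ 0%N) //.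
  have -> : `|(0%N : int) - (0%N : int)|%N = 0%N by lia.
  have -> : `|(1%N : int) - (0%N : int)|%N = 1%N by lia.
  by rewrite expr0 expr1; ring.
move=> k kj; have [d ed] : exists d, `|(1%N : int) - (k : int)|%N = d by eexists.
have -> : `|(0%N : int) - (k : int)|%N = d.+1 by lia.
by rewrite ed !exprS; ring.
Qed.

(** Two solutions with the same parity are proportional.  The Casoratian
    Y_j s_(j+1) - Y_(j+1) s_j does not depend on j by the recurrence, while the
    reflection j -> n - j changes its sign. *)
Lemma casoratian_eq0 n c (t : C) (Y s : nat -> C) : t * t = 1 ->
  (forall j, (j.+1 < n)%N -> Y j + Y j.+2 = c * Y j.+1) ->
  (forall j, (j.+1 < n)%N -> s j + s j.+2 = c * s j.+1) ->
  (forall j, (0 < j <= n)%N -> Y (n.+1 - j)%N = t * Y j) ->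
  (forall j, (0 < j <= n)%N -> s (n.+1 - j)%N = t * s j) ->
  (2 <= n)%N -> Y 0%N * s 1%N = Y 1%N * s 0%N.
Proof.
move=> tt hY hs rY rs hn.
pose w j := Y j * s j.+1 - Y j.+1 * s j.
have wS j : (j.+1 < n)%N -> w j.+1 = w j.
  move=> jn; rewrite /w.
  have -> : s j.+2 = c * s j.+1 - s j by rewrite -hs //; ring.
  have -> : Y j.+2 = c * Y j.+1 - Y j by rewrite -hY //; ring.
  ring.
have w0 j : (j < n)%N -> w j = w 0%N.
  by elim: j => // j ih jn; rewrite wS // ih // ltnW.
(* The reflection j -> n - j for j = 1. *)
have wanti : w n.-1 = - w 1%N.
  rewrite /w prednK; last by lia.
  have en : n = (n.+1 - 1)%N by lia.
  have en1 : n.-1 = (n.+1 - 2)%N by lia.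
  rewrite {2 3}en en1 !rY ?rs; try lia.
  have -> : t * Y 2%N * (t * s 1%N) - t * Y 1%N * (t * s 2%N) =
    (t * t) * (Y 2%N * s 1%N - Y 1%N * s 2%N) by ring.
  by rewrite tt; ring.
have /eqP : w 0%N = - w 0%N.
  by rewrite -{1}(w0 n.-1) ?wanti ?w0 //; lia.
by rewrite -addr_eq0 -mulr2n mulrn_eq0 /= subr_eq0 => /eqP.
Qed.

(** The eigenvector, shifted by one and preceded by rho y_0, solves the recurrence:
    this turns the boundary row into one more instance of the interior ones.  Its
    entry at 1, namely y_0, is not 0 as otherwise all entries would vanish.  Hence
    the vanishing Casoratian with s can be divided by it. *)
Lemma eigenvector_secular n rho lam kappa (t : C) (y : 'cV[C]_n) (s : nat -> C) :
  t * t = 1 -> (2 <= n)%N -> rho != 0 -> lam != 0 ->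
  lam * kappa = 1 - rho ^+ 2 ->
  eigenvector (KMS n rho) lam y ->
  (forall j, y (rev_ord j) 0 = t * y j 0) ->
  (forall j, (j.+1 < n)%N -> rho * (s j + s j.+2) = (1 + rho ^+ 2 - kappa) * s j.+1) ->
  (forall j, (0 < j <= n)%N -> s (n.+1 - j)%N = t * s j) ->
  rho * s 1%N = s 0%N.
Proof.
move=> tt hn rho0 lam0 hk [y0 Ky] ry hs rs.
case: n hn y y0 Ky ry hs rs => // n hn y y0 Ky ry hs rs.
pose W k := y (inord k) 0.
have yW (k : 'I_n.+1) : y k 0 = W k by rewrite /W inord_val.
have KW j : (j < n.+1)%N -> ksum n.+1 rho W j = lam * W j.
  move=> jn; have := KMS_mulE rho (Ordinal jn) yW.
  by rewrite Ky mxE yW => /esym.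
pose Y k := if k is k'.+1 then W k' else rho * W 0%N.
have hY j : (j.+1 < n.+1)%N -> rho * (Y j + Y j.+2) = (1 + rho ^+ 2 - kappa) * Y j.+1.
  case: j => [|j] jn; apply: (mulfI lam0).
    have := ksum_boundary rho W (ltnW jn); rewrite !KW //; try lia.
    rewrite -hk => e /=.
    have -> : lam * (rho * (rho * W 0%N + W 1%N)) =
      lam * rho ^+ 2 * W 0%N + lam * W 0%N - (lam * W 0%N - rho * (lam * W 1%N)) by ring.
    by rewrite e; ring.
  have := ksum_interior rho W (ltnW jn); rewrite !KW //; try lia.
  rewrite -hk => e /=.
  have -> : lam * (rho * (W j + W j.+2)) = (1 + rho ^+ 2) * (lam * W j.+1) -
     ((1 + rho ^+ 2) * (lam * W j.+1) - rho * (lam * W j) - rho * (lam * W j.+2)) by ring.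
  by rewrite e; ring.
have rec (a : nat -> C) : (forall j, (j.+1 < n.+1)%N -> rho * (a j + a j.+2) =
    (1 + rho ^+ 2 - kappa) * a j.+1) -> forall j, (j.+1 < n.+1)%N ->
    a j + a j.+2 = (1 + rho ^+ 2 - kappa) / rho * a j.+1.
  by move=> ha j jn; apply: (mulfI rho0); rewrite ha // mulrA mulrCA divff // mulr1.
have Y1 : Y 1%N != 0.
  apply: contra y0 => /eqP Y1.
  have Yz j : (j <= n)%N -> Y j = 0 /\ Y j.+1 = 0.
    elim: j => [|j ih] jn; first by rewrite Y1 /= -[W 0%N]/(Y 1%N) Y1 mulr0.
    have [e1 e2] := ih (ltnW jn); split => //.
    by have := rec _ hY j jn; rewrite e1 e2 mulr0 add0r.
  by apply/eqP/matrixP => i k; rewrite ord1 mxE yW; have [] := Yz i (leq_ord i).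
have rY j : (0 < j <= n.+1)%N -> Y (n.+2 - j)%N = t * Y j.
  case: j => // j jn; have jn' : (j < n.+1)%N by lia.
  have := ry (Ordinal jn'); rewrite !yW /= => e.
  have -> : (n.+2 - j.+1 = (n.+1 - j.+1).+1)%N by lia.
  by rewrite /= e.
have := casoratian_eq0 tt (rec _ hY) (rec _ hs) rY rs hn.
rewrite [Y 0%N]/= -[W 0%N]/(Y 1%N) => e; apply: (mulfI Y1); rewrite -e; ring.
Qed.

(** With d_k = s_k - rho s_(k+1) and e_k = s_(k+1) - rho s_k, the recurrence reads
    kappa s_(k+1) = d_(k+1) - rho d_k = e_k - rho e_(k+1).  The sum for k < j
    telescopes with the first form and the sum for k >= j with the second one; the
    boundary conditions are d_0 = 0 and e_n = 0. *)
Lemma ksum_telescope n rho kappa (s : nat -> C) j : (j < n)%N ->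
  s 0%N = rho * s 1%N -> s n.+1 = rho * s n ->
  (forall k, (k < n)%N -> rho * (s k + s k.+2) = (1 + rho ^+ 2 - kappa) * s k.+1) ->
  kappa * ksum n rho (fun k => s k.+1) j = (1 - rho ^+ 2) * s j.+1.
Proof.
move=> jn s0 sn hs.
have hk k : (k < n)%N -> kappa * s k.+1 = (1 + rho ^+ 2) * s k.+1 - rho * (s k + s k.+2).
  by move=> kn; rewrite hs //; ring.
rewrite /ksum (@big_cat_nat _ _ _ j) //=; last exact: ltnW.
pose u k := rho ^+ (j.+1 - k) * (s k - rho * s k.+1).
pose v k := - (rho ^+ (k - j) * (s k.+1 - rho * s k)).
rewrite mulrDr !mulr_sumr.
rewrite (@eq_big_nat _ _ _ 0 j _ (fun k => u k.+1 - u k)); last first.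
  move=> k /andP[_ kj]; rewrite /u mulrCA hk; last by lia.
  have [d ed] : exists d, (j - k)%N = d by eexists.
  have -> : `|(j : int) - (k : int)|%N = d by lia.
  have -> : (j.+1 - k.+1 = d)%N by lia.
  have -> : (j.+1 - k = d.+1)%N by lia.
  by rewrite (exprS _ d); ring.
rewrite (@eq_big_nat _ _ _ j n _ (fun k => v k.+1 - v k)); last first.
  move=> k /andP[kj kn]; rewrite /v mulrCA hk //.
  have [d ed] : exists d, (k - j)%N = d by eexists.
  have -> : `|(j : int) - (k : int)|%N = d by lia.
  have -> : (k.+1 - j = d.+1)%N by lia.
  by rewrite ed (exprS _ d); ring.
rewrite !telescope_sumr //; last exact: ltnW.
rewrite /u /v s0 sn !subrr !mulr0 subnn subSnn expr0 expr1; ring.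
Qed.

(** When rho = 1 or rho = -1, the entry at (j, k) is rho^j rho^k, and a solution of
    the recurrence with the boundary condition is a multiple of rho^j. *)
Lemma ksum_rank1 n rho (s : nat -> C) j : (j < n)%N -> rho ^+ 2 = 1 ->
  s 0%N = rho * s 1%N ->
  (forall k, (k < n)%N -> s k + s k.+2 = 2 * rho * s k.+1) ->
  ksum n rho (fun k => s k.+1) j = n%:R * s j.+1.
Proof.
move=> jn r2 s0 hs.
have sS k : (k <= n)%N -> s k = rho * s k.+1.
  elim: k => // k ih kn; have := hs k kn; rewrite (ih (ltnW kn)) => h.
  have -> : s k.+2 = rho * s k.+1.
    by apply: (addrI (rho * s k.+1)); rewrite h; ring.
  by rewrite mulrA -expr2 r2 mul1r.
have sE k : (k <= n)%N -> s k.+1 = rho ^+ k * s 1%N.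
  elim: k => [|k ih] kn; first by rewrite expr0 mul1r.
  have := sS k.+1 kn; rewrite ih ?(ltnW kn) // => h.
  by rewrite exprS -mulrA h mulrA -expr2 r2 mul1r.
rewrite /ksum (@eq_big_nat _ _ _ _ _ _ (fun=> s j.+1)).
  by rewrite sumr_const_nat subn0 mulr_natl.
have par a : rho ^+ (2 * a) = 1 by rewrite exprM r2 expr1n.
move=> k /andP[_ kn]; rewrite (sE k) ?(sE j); try lia.
rewrite mulrA -exprD; congr (_ * _).
case: (leqP k j) => kj; first by congr (_ ^+ _); lia.
have -> : (`|(j : int) - (k : int)| + k = 2 * (k - j) + j)%N by lia.
by rewrite exprD par mul1r.
Qed.

(** The vector has entries s_1, ..., s_n; s_0 and s_(n+1) are the values beyond its
    two ends. *)
Lemma eigenvector_of_seq n rho lam (t : C) (s : nat -> C) :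
  (0 < n)%N -> s 1%N != 0 ->
  (forall j, (j <= n.+1)%N -> s (n.+1 - j)%N = t * s j) ->
  (forall j, (j < n)%N -> ksum n rho (fun k => s k.+1) j = lam * s j.+1) ->
  exists y : 'cV[C]_n, (forall j, y (rev_ord j) 0 = t * y j 0) /\
     eigenvector (KMS n rho) lam y.
Proof.
move=> n0 s1 rs hs; exists (\col_(j < n) s j.+1); split; [|split].
- move=> j; have jn := ltn_ord j; rewrite !mxE /= -rs; last by lia.
  by congr s; lia.
- apply: contra s1 => /eqP/matrixP/(_ (Ordinal n0) 0); rewrite !mxE /= => ->.
  exact: eqxx.
- apply/matrixP => i k; rewrite ord1 (@KMS_mulE _ _ _ (fun k => s k.+1)).
    by rewrite -/(ksum _ _ _ _) hs // !mxE.
  by move=> j; rewrite mxE.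
Qed.

End KacMurdockSzego.

(** * The imaginary part v(n, u) *)

Section ImaginaryPart.
Variable R : realType.
Implicit Types (x y t u : R).

Lemma cosh_ge1 x : 1 <= cosh x.
Proof.
rewrite /cosh expRN; have := expR_gt0 x; move: (expR x) => a a0.
have : 0 <= (a - 1) ^+ 2 / a by rewrite divr_ge0 ?sqr_ge0 ?ltW.
have -> : (a - 1) ^+ 2 / a = a + a^-1 - 2 by field; rewrite gt_eqF.
lra.
Qed.

Lemma sinh0 : sinh 0 = 0 :> R.
Proof. by rewrite /sinh oppr0 subrr mul0r. Qed.

Lemma lt_sinh x y : x < y -> sinh x < sinh y.
Proof.
move=> xy; rewrite /sinh ltr_pM2r ?invr_gt0 ?ltr0n //.
have : expR x < expR y by rewrite ltr_expR.
have : expR (- y) < expR (- x) by rewrite ltr_expR ltrN2.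
lra.
Qed.

Lemma sinh_ge0 x : 0 <= x -> 0 <= sinh x.
Proof.
rewrite le_eqVlt => /predU1P[<-|x0]; first by rewrite sinh0.
by rewrite -sinh0 ltW // lt_sinh.
Qed.

Lemma sinh_ge_half x : 0 <= x -> x / 2 <= sinh x.
Proof.
move=> x0; rewrite /sinh ler_pM2r ?invr_gt0 ?ltr0n //.
have := expR_ge1Dx x; have : expR (- x) <= 1 by rewrite -expR0 ler_expR oppr_le0.
lra.
Qed.

Lemma le_cosh x y : 0 <= x -> x <= y -> cosh x <= cosh y.
Proof.
move=> x0 xy; have sxy : sinh x <= sinh y.
  by move: xy; rewrite le_eqVlt => /predU1P[->//|/lt_sinh/ltW].
have := cosh2Bsinh2 x; have := cosh2Bsinh2 y; have := cosh_ge1 x; have := cosh_ge1 y.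
have := sinh_ge0 x0; nra.
Qed.

Lemma cosh_gt1 x : 0 < x -> 1 < cosh x.
Proof.
move=> x0; have s0 : 0 < sinh x by rewrite -sinh0 lt_sinh.
have := cosh2Bsinh2 x; have := cosh_ge1 x; nra.
Qed.

(** sinh (m t) / sinh t by the addition formula, without a singularity at t = 0.
    Its value at 0 is m, and it is nondecreasing on t >= 0 because each summand
    is. *)
Fixpoint sinh_ratio m t : R := if m is m'.+1 then cosh t * sinh_ratio m' t + cosh (m'%:R * t) else 0.

Lemma sinh_ratioE m t : sinh (m%:R * t) = sinh_ratio m t * sinh t.
Proof.
elim: m => [|m ih]; first by rewrite mul0r sinh0 mul0r.
rewrite -addn1 natrD mulrDl mul1r sinhD ih addn1 /=; ring.
Qed.

Lemma sinh_ratio_ge m t : m%:R <= sinh_ratio m t.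
Proof.
elim: m => // m ih; rewrite -addn1 natrD addn1 /=.
have := cosh_ge1 t; have := cosh_ge1 (m%:R * t); have : 0 <= m%:R :> R by [].
nra.
Qed.

Lemma sinh_ratio_gt m t : (2 <= m)%N -> 0 < t -> m%:R < sinh_ratio m t.
Proof.
case: m => // m m1 t0; rewrite -addn1 natrD addn1 /=.
have := cosh_ge1 t; have := sinh_ratio_ge m t; have : 0 <= m%:R :> R by [].
have : 1 < cosh (m%:R * t) by rewrite cosh_gt1 // mulr_gt0 // ltr0n.
nra.
Qed.

Lemma le_sinh_ratio m s t : 0 <= s -> s <= t -> sinh_ratio m s <= sinh_ratio m t.
Proof.
move=> s0 st; elim: m => //= m ih.
apply: lerD; last by rewrite le_cosh ?mulr_ge0 // ler_wpM2l.
apply: ler_pM => //; first exact: le_trans (cosh_ge1 _).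
  by apply: le_trans (sinh_ratio_ge _ _).
exact: le_cosh.
Qed.

Section Phi.
Variable n : nat.
Hypothesis n2 : (2 <= n)%N.

Definition phi t : R := sinh (n%:R * t) ^+ 2 - n%:R ^+ 2 * sinh t ^+ 2.

Lemma phiE t : phi t = sinh t ^+ 2 * (sinh_ratio n t ^+ 2 - n%:R ^+ 2).
Proof. by rewrite /phi sinh_ratioE; ring. Qed.

Lemma phi0 : phi 0 = 0.
Proof. by rewrite phiE sinh0; ring. Qed.

Lemma sinh_ratio_sqr_gt t : 0 < t -> 0 < sinh_ratio n t ^+ 2 - n%:R ^+ 2.
Proof.
move=> t0; have := sinh_ratio_gt n2 t0; have : 0 <= n%:R :> R by [].
rewrite subr_gt0; nra.
Qed.

(** Write phi as sinh^2 t (r^2 - n^2) with r = sinh (n t) / sinh t: both factors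
    are nonnegative and nondecreasing on t >= 0, the first one strictly, and the
    second one is positive for t > 0. *)
Lemma lt_phi s t : 0 <= s -> s < t -> phi s < phi t.
Proof.
move=> s0 st; rewrite !phiE; have t0 : 0 < t by exact: le_lt_trans st.
have h1 := le_sinh_ratio n s0 (ltW st); have h2 := sinh_ratio_sqr_gt t0; have h3 := lt_sinh st.
have h4 := sinh_ge0 s0; have h5 := sinh_ratio_ge n s; have : 0 <= n%:R :> R by [] => h6.
have h7 : sinh_ratio n s ^+ 2 - n%:R ^+ 2 <= sinh_ratio n t ^+ 2 - n%:R ^+ 2 by nra.
have h8 : sinh s ^+ 2 < sinh t ^+ 2 by nra.
apply: (@le_lt_trans _ _ (sinh s ^+ 2 * (sinh_ratio n t ^+ 2 - n%:R ^+ 2))).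
  by rewrite ler_wpM2l ?sqr_ge0.
by rewrite ltr_pM2r.
Qed.

Lemma phi_inj s t : 0 <= s -> 0 <= t -> phi s = phi t -> s = t.
Proof.
move=> s0 t0 e; case: (ltgtP s t) => // h.
  by have := lt_phi s0 h; rewrite e ltxx.
by have := lt_phi t0 h; rewrite e ltxx.
Qed.

Lemma continuous_sinh : continuous (@sinh R).
Proof.
move=> x; apply: cvgM; last exact: cvg_cst.
apply: cvgB; first exact: continuous_expR.
by apply: (@continuous_comp _ _ _ -%R expR); [exact: oppr_continuous|exact: continuous_expR].
Qed.

Lemma continuous_phi : continuous phi.
Proof.
move=> x; apply: cvgB; last first.
  apply: cvgM; first exact: cvg_cst.
  by apply: (@continuous_comp _ _ _ (@sinh R) (fun t => t ^+ 2)); [exact: continuous_sinh|exact: exprn_continuous].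
apply: (@continuous_comp _ _ _ (fun t => sinh (n%:R * t)) (fun t => t ^+ 2)); last exact: exprn_continuous.
apply: (@continuous_comp _ _ _ (fun t => n%:R * t) (@sinh R)); last exact: continuous_sinh.
exact: mulrl_continuous.
Qed.

(** The second factor of phi is at least its value k > 0 at 1 from there on, and
    sinh t >= t / 2, so phi exceeds x at a suitable b and the intermediate value
    theorem applies. *)
Lemma phi_surj x : 0 <= x -> exists2 t, 0 <= t & phi t = x.
Proof.
move=> x0; set k := sinh_ratio n 1 ^+ 2 - n%:R ^+ 2; have k0 : 0 < k := sinh_ratio_sqr_gt ltr01.
(* sinh b >= b / 2 >= x / k + 1, so sinh^2 b >= x / k. *)
pose b := 1 + 2 * (x / k + 1).
have xk : 0 <= x / k by rewrite divr_ge0 // ltW.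
have b1 : 1 <= b by rewrite /b; lra.
have hb : x <= phi b.
  rewrite phiE; have h1 := le_sinh_ratio n ler01 b1; have h5 := sinh_ratio_ge n 1; have h6 : 0 <= n%:R :> R by [].
  have h7 : k <= sinh_ratio n b ^+ 2 - n%:R ^+ 2 by rewrite /k; nra.
  have h8 : x / k + 1 <= sinh b by apply: le_trans (sinh_ge_half _); rewrite /b; lra.
  have h9 : x / k <= sinh b ^+ 2 by nra.
  rewrite -(divfK (lt0r_neq0 k0) x); apply: ler_pM => //; exact: ltW.
have b0 : 0 <= b by lra.
have := @IVT _ phi 0 b x b0.
case.
- by apply: continuous_subspaceT => z; exact: continuous_phi.
- by rewrite phi0 (min_idPl _) ?(max_idPr _) ?x0 //; exact: le_trans hb.
- by move=> t; rewrite in_itv /= => /andP[t0 _] <-; exists t.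
Qed.

Lemma norm_sin_nat m u : `|sin (m%:R * u)| <= m%:R * `|sin u|.
Proof.
elim: m => [|m ih]; first by rewrite mul0r sin0 normr0 mul0r.
rewrite -addn1 natrD !mulrDl !mul1r sinD; apply: le_trans (ler_normD _ _) _.
apply: lerD; rewrite normrM.
  by apply: le_trans ih; rewrite ler_piMr // cos_max.
by rewrite ler_piMl // cos_max.
Qed.

(** |cos u| < 1 makes the induction step of [norm_sin_nat] strict. *)
Lemma norm_sin_nat_lt m u : (2 <= m)%N -> sin u != 0 -> `|sin (m%:R * u)| < m%:R * `|sin u|.
Proof.
case: m => // m; rewrite ltnS => m0 su.
rewrite -addn1 natrD !mulrDl !mul1r sinD; apply: le_lt_trans (ler_normD _ _) _.
rewrite !normrM.
have c1 : `|cos u| < 1 by rewrite lt_neqAle cos_max andbT norm_cos_eq1.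
have := norm_sin_nat m u; have : 0 < `|sin u| by rewrite normr_gt0.
have : 1 <= m%:R :> R by rewrite ler1n.
have := cos_max (m%:R * u); have := normr_ge0 (sin (m%:R * u)); have := normr_ge0 (cos u).
move: (m%:R : R) `|sin (m%:R * u)| `|cos u| `|cos (m%:R * u)| `|sin u| c1 => M a c b d.
move=> c1 c0 a0 b1 M1 d0 h.
have h1 : a * c <= M * d * c by rewrite ler_wpM2r.
have Md : 0 < M * d by nra.
have h2 : M * d * c < M * d by rewrite -subr_gt0 -{1}[M * d]mulr1 -mulrBr mulr_gt0 // subr_gt0.
have h3 : b * d <= d by rewrite -{2}[d]mul1r ler_wpM2r // ltW.
lra.
Qed.

Lemma g_ge0 u : 0 <= g n u.
Proof.
rewrite /g -(real_normK (num_real (sin u))) -(real_normK (num_real (sin _))).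
rewrite subr_ge0 -exprMn lerXn2r ?nnegrE ?mulr_ge0 //; exact: norm_sin_nat.
Qed.

Lemma g_eq0 u : g n u = 0 -> sin u = 0.
Proof.
move=> h; apply/eqP/negPn/negP => su; have := norm_sin_nat_lt n2 su.
rewrite -(@ltr_pXn2r _ 2) ?nnegrE ?mulr_ge0 // exprMn !real_normK ?num_real //.
by rewrite -subr_gt0 -/(g n u) h ltxx.
Qed.

Lemma v_spec u : 0 <= v n u /\ phi (v n u) = g n u.
Proof.
have [t t0 ht] := phi_surj (g_ge0 u).
rewrite /v; case: xgetP => [_ _ //|/(_ t) []].
by split.
Qed.

Lemma v_uniq u t : 0 <= t -> phi t = g n u -> v n u = t.
Proof. by move=> t0 e; have [h1 h2] := v_spec u; apply: phi_inj; rewrite // h2. Qed.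

Lemma v_eq0_sin u : v n u = 0 -> sin u = 0.
Proof. by move=> e; have [_] := v_spec u; rewrite e phi0 => /esym/g_eq0. Qed.

Lemma sin0_v u : sin u = 0 -> v n u = 0.
Proof.
move=> su; apply: v_uniq => //; rewrite phi0.
have := norm_sin_nat n u; rewrite su normr0 mulr0 normr_le0 => /eqP s0.
by rewrite /g su s0; ring.
Qed.

Lemma continuous_g : continuous (g (R := R) n).
Proof.
move=> x; apply: cvgB.
  apply: cvgM; first exact: cvg_cst.
  by apply: (@continuous_comp _ _ _ (@sin R) (fun t => t ^+ 2)); [exact: continuous_sin|exact: exprn_continuous].
apply: (@continuous_comp _ _ _ (fun t => sin (n%:R * t)) (fun t => t ^+ 2)); last exact: exprn_continuous.
apply: (@continuous_comp _ _ _ (fun t => n%:R * t) (@sin R)); last exact: continuous_sin.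
exact: mulrl_continuous.
Qed.

(** As phi is strictly increasing, bounding v(w) within e of v(u) amounts to
    bounding g(w) = phi (v(w)) strictly between the values of phi at v(u) - e and
    v(u) + e (only the latter if v(u) < e), which is possible near u by continuity
    of g. *)
Lemma continuous_v : continuous (v (R := R) n).
Proof.
move=> u; apply/cvgrPdist_lt => e e0.
have [t0 ht] := v_spec u.
have gc := @continuous_g u.
have up : \forall w \near u, v n w < v n u + e.
  have h : g n u < phi (v n u + e) by rewrite -ht lt_phi // ltrDl.
  have : \forall w \near u, g n w < phi (v n u + e)
    by exact: (@cvgr_lt _ _ (nbhs u) _ (g n) (g n u) gc _ h).
  apply: filterS => w hw.
  rewrite ltNge; apply/negP => hle; have [w0 hw'] := v_spec w.
  move: hw; rewrite -hw'; apply/negP; rewrite -leNgt.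
  move: hle; rewrite le_eqVlt => /predU1P[->//|h'].
  by apply/ltW/lt_phi => //; rewrite addr_ge0 // ltW.
have dn : \forall w \near u, v n u - e < v n w.
  have [he|he] := ltP (v n u - e) 0.
    by near=> w; have [w0 _] := v_spec w; exact: lt_le_trans w0.
  have h : phi (v n u - e) < g n u by rewrite -ht lt_phi // ltrBlDr ltrDl.
  have : \forall w \near u, phi (v n u - e) < g n w
    by exact: (@cvgr_gt _ _ (nbhs u) _ (g n) (g n u) gc _ h).
  apply: filterS => w hw.
  rewrite ltNge; apply/negP => hle; have [w0 hw'] := v_spec w.
  move: hw; rewrite -hw'; apply/negP; rewrite -leNgt.
  move: hle; rewrite le_eqVlt => /predU1P[->//|h'].
  exact/ltW/lt_phi.
apply: filterS2 up dn => w h1 h2; rewrite ltr_norml; apply/andP; split; lra.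
Unshelve. all: by end_near.
Qed.

End Phi.
End ImaginaryPart.

(** * Continuity and removable singularities over the complex numbers *)

Section Topology.
Variable R : realType.
Local Notation C := (R[i]^o).

Lemma norm_real_complex (x : R) : `|x%:C| = `|x|%:C.
Proof. by rewrite normc_def /= expr0n addr0 sqrtr_sqr. Qed.

Lemma norm_complex_le (x y : R) : `|x +i* y| <= (`|x| + `|y|)%:C.
Proof.
have -> : x +i* y = x%:C + 'i%C * y%:C by simpc.
apply: le_trans (ler_normD _ _) _.
have i1 : `|'i%C| = 1 :> R[i] by rewrite normc_def /= expr0n expr1n add0r sqrtr1.
by rewrite normrM i1 mul1r !norm_real_complex rmorphD.
Qed.

Lemma norm_Im_le (z : R[i]) : `|complex.Im z|%:C <= `|z|.
Proof.
case: z => a b; rewrite normc_def /= lecR -sqrtr_sqr ler_wsqrtr // lerDr sqr_ge0 //.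
Qed.

Lemma continuous_Re : continuous (fun w : C => complex.Re w : R).
Proof.
move=> w; apply/(@cvgrPdist_lt _ R C (nbhs w) (nbhs_filter w)) => e e0.
have e0' : 0 < e%:C :> R[i] by rewrite ltcR.
have : nbhs (w : C) (ball (w : C) e%:C) by exact: nbhsx_ballx.
apply: filterS => z /=; rewrite -ltcR; apply: le_lt_trans.
by have := normc_ge_Re (w - z); case: (w) (z) => a b [c d].
Qed.

Lemma continuous_Im : continuous (fun w : C => complex.Im w : R).
Proof.
move=> w; apply/(@cvgrPdist_lt _ R C (nbhs w) (nbhs_filter w)) => e e0.
have e0' : 0 < e%:C :> R[i] by rewrite ltcR.
have : nbhs (w : C) (ball (w : C) e%:C) by exact: nbhsx_ballx.
apply: filterS => z /=; rewrite -ltcR; apply: le_lt_trans.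
by have := norm_Im_le (w - z); case: (w) (z) => a b [c d].
Qed.

Lemma cvg_complex (T : Type) (F : set_system T) (FF : Filter F) (f h : T -> R) (a b : R) :
  f @ F --> a -> h @ F --> b -> (fun t => (f t +i* h t : C)) @ F --> (a +i* b : C).
Proof.
move=> fa hb; apply/cvgrPdist_lt => e e0.
have [e1 e2] : 0 < complex.Re e /\ e = (complex.Re e)%:C.
  by move: e0; case: (e) => x y; rewrite ltcE /= => /andP[/eqP -> ->].
set r := complex.Re e in e1 e2; rewrite e2.
have r2 : 0 < r / 2 by rewrite divr_gt0.
move/cvgrPdist_lt/(_ _ r2) : fa => fa; move/cvgrPdist_lt/(_ _ r2) : hb => hb.
apply: filterS2 fa hb => t h1 h2.
have -> : a +i* b - (f t +i* h t) = (a - f t) +i* (b - h t) by simpc.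
apply: le_lt_trans (norm_complex_le _ _) _; rewrite ltcR; lra.
Qed.

Lemma continuous_cexp : continuous (@cexp R : C -> C).
Proof.
have -> : (@cexp R : C -> C) = fun z => (expR (complex.Re z) * cos (complex.Im z)) +i*
     (expR (complex.Re z) * sin (complex.Im z)).
  by apply/funext => z; rewrite /cexp; simpc.
move=> z; apply: (@cvg_complex _ _ (nbhs_filter z)); apply: cvgM.
- by apply: (@continuous_comp _ _ _ (fun w : C => complex.Re w : R)); [exact: continuous_Re|exact: continuous_expR].
- by apply: (@continuous_comp _ _ _ (fun w : C => complex.Im w : R)); [exact: continuous_Im|exact: continuous_cos].
- by apply: (@continuous_comp _ _ _ (fun w : C => complex.Re w : R)); [exact: continuous_Re|exact: continuous_expR].
- by apply: (@continuous_comp _ _ _ (fun w : C => complex.Im w : R)); [exact: continuous_Im|exact: continuous_sin].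
Qed.

Lemma continuous_for_cst (a z : C) : {for z, continuous (fun _ : C => a)}.
Proof. exact: (@cvg_cst _ _ _ _ (nbhs_filter z)). Qed.

Lemma continuous_for_id (z : C) : {for z, continuous (fun w : C => w)}.
Proof. exact: cvg_id. Qed.

Lemma continuous_forD (f h : C -> C) (z : C) : {for z, continuous f} -> {for z, continuous h} ->
  {for z, continuous (fun w => f w + h w : C)}.
Proof. exact: (@cvgD _ _ _ (nbhs z) (nbhs_filter z)). Qed.

Lemma continuous_forN (f : C -> C) (z : C) : {for z, continuous f} ->
  {for z, continuous (fun w => - f w : C)}.
Proof. exact: (@cvgN _ _ _ (nbhs z) (nbhs_filter z)). Qed.

Lemma continuous_forM (f h : C -> C) (z : C) : {for z, continuous f} -> {for z, continuous h} ->
  {for z, continuous (fun w => (f w : R[i]) * h w : C)}.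
Proof. exact: (@cvgM _ _ (nbhs z) (nbhs_filter z)). Qed.

Lemma continuous_forV (f : C -> C) (z : C) : f z != 0 -> {for z, continuous f} ->
  {for z, continuous (fun w => (f w : R[i])^-1 : C)}.
Proof. exact: (@cvgV _ _ (nbhs z) (nbhs_filter z)). Qed.

Lemma continuous_for_comp (f h : C -> C) (z : C) : {for z, continuous f} -> {for f z, continuous h} ->
  {for z, continuous (fun w => h (f w))}.
Proof. exact: continuous_comp. Qed.

Lemma continuous_cexpi : continuous (fun z : C => cexp ('i%C * z) : C).
Proof.
move=> z; apply: (@continuous_for_comp (fun z : C => 'i%C * z : C) (@cexp R : C -> C)).
  by apply: continuous_forM; [exact: continuous_for_cst|exact: continuous_for_id].
exact: continuous_cexp.
Qed.

Lemma continuous_cexpNi : continuous (fun z : C => cexp (- ('i%C * z)) : C).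
Proof.
move=> z; apply: (@continuous_for_comp (fun z : C => - ('i%C * z) : C) (@cexp R : C -> C)).
  by apply: continuous_forN; apply: continuous_forM; [exact: continuous_for_cst|exact: continuous_for_id].
exact: continuous_cexp.
Qed.

Lemma continuous_csin : continuous (@csin R : C -> C).
Proof.
move=> z.
apply: (@continuous_forM (fun w => cexp ('i%C * w) - cexp (- ('i%C * w))) (fun=> (2 * 'i%C)^-1) z); last exact: continuous_for_cst.
by apply: continuous_forD; [exact: continuous_cexpi|apply: continuous_forN; exact: continuous_cexpNi].
Qed.

Lemma continuous_ccos : continuous (@ccos R : C -> C).
Proof.
move=> z.
apply: (@continuous_forM (fun w => cexp ('i%C * w) + cexp (- ('i%C * w))) (fun=> 2^-1) z); last exact: continuous_for_cst.
by apply: continuous_forD; [exact: continuous_cexpi|exact: continuous_cexpNi].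
Qed.

Lemma continuous_trig b : continuous (@trig R b : C -> C).
Proof. by case: b; [exact: continuous_csin|exact: continuous_ccos]. Qed.

Lemma continuous_trig_scale b (a : R[i]) : continuous (fun w : C => trig b (a * w / 2) : C).
Proof.
move=> z; apply: (@continuous_for_comp (fun z : C => a * z / 2 : C) (@trig R b : C -> C)).
  by apply: continuous_forM; [apply: continuous_forM; [exact: continuous_for_cst|exact: continuous_for_id]|exact: continuous_for_cst].
exact: continuous_trig.
Qed.

(** sin (m h) / sin h by the addition formula, continuous at h = 0 with value m. *)
Fixpoint csin_ratio m (h : R[i]) : R[i] :=
  if m is m'.+1 then ccos h * csin_ratio m' h + ccos (m'%:R * h) else 0.

Lemma csin_ratioE m h : csin (m%:R * h) = csin_ratio m h * csin h.
Proof.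
elim: m => [|m ih]; first by rewrite mul0r csin0 mul0r.
rewrite -addn1 natrD mulrDl mul1r csinD ih addn1 /=; ring.
Qed.

Lemma csin_ratio0 m : csin_ratio m 0 = m%:R.
Proof.
elim: m => //= m ih; rewrite mulr0 ccos0 ih mul1r -addn1 natrD //.
Qed.

Lemma continuous_csin_ratio m : continuous (csin_ratio m : C -> C).
Proof.
elim: m => [|m ih] z; first exact: continuous_for_cst.
apply: (@continuous_forD (fun w => ccos w * csin_ratio m w) (fun w => ccos (m%:R * w)) z).
  by apply: continuous_forM; [exact: continuous_ccos|exact: ih].
apply: (@continuous_for_comp (fun z : C => m%:R * z : C) (@ccos R : C -> C)).
  by apply: continuous_forM; [exact: continuous_for_cst|exact: continuous_for_id].
exact: continuous_ccos.
Qed.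

Lemma continuous_for_near (f h : C -> C) (z : C) : nbhs z (fun w => h w = f w) ->
  {for z, continuous h} -> {for z, continuous f}.
Proof.
move=> H hc; have e : h z = f z := nbhs_singleton H.
have : f @ z --> h z.
  apply: cvg_trans hc; apply: (@near_eq_cvg _ _ _ (nbhs_filter z)).
  by apply: (@filterS _ _ (nbhs_filter z)) H => w ->.
by rewrite e.
Qed.

Lemma quotient_ext_regular (p q : C -> C) (z : C) :
  {for z, continuous p} -> {for z, continuous q} -> q z != 0 ->
  quotient_ext p q z = p z / q z /\ {for z, continuous (quotient_ext p q)}.
Proof.
move=> pc qc qz.
have E w : q w != 0 -> p w / q w = quotient_ext p q w.
  by move=> /negbTE h; rewrite /quotient_ext h andbF.
split; first by rewrite -E.
apply: (@continuous_for_near _ (fun w => (p w : R[i]) / q w)); last exact: (continuous_forM pc (continuous_forV qz qc)).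
have H : nbhs z (fun w => q w != 0) := @cvgr_neq0 _ _ _ _ (nbhs_filter z) _ _ qc qz.
exact: (@filterS _ _ (nbhs_filter z) _ _ E H).
Qed.

(** Near z, the extended quotient agrees with G: off z by hypothesis, and at z since
    the limit defining its value is a limit of G. *)
Lemma quotient_ext_singular (p q G : C -> C) (z : C) :
  {for z, continuous G} -> p z = 0 -> q z = 0 ->
  (\forall w \near z^', q w != 0 /\ p w / q w = G w) ->
  quotient_ext p q z = G z /\ {for z, continuous (quotient_ext p q)}.
Proof.
move=> Gc pz qz H.
have Ez : quotient_ext p q z = G z.
  rewrite /quotient_ext pz qz eqxx /=.
  apply/(@cvg_lim _ (@norm_hausdorff _ C) _ _ (Proper_dnbhs_regular_numFieldType z)).
  apply: (@cvg_trans _ (G @ z^')).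
    apply: (@near_eq_cvg _ _ _ (dnbhs_filter z)).
    by apply: (@filterS _ _ (dnbhs_filter z)) H => w [].
  exact: cvg_within_filter.
split; first exact: Ez.
apply: (@continuous_for_near _ G); last exact: Gc.
apply: (@filterS _ _ (nbhs_filter z)) H => w h.
have [->//|wz] := eqVneq w z.
have [h1 h2] := h wz.
by rewrite /quotient_ext (negbTE h1) andbF.
Qed.
End Topology.

(** * The curves as functions of the complex parameter *)

Section Curve.
Variable R : realType.
Variable n : nat.
Hypothesis n2 : (2 <= n)%N.
Local Notation C := (R[i]^o).
Implicit Types (z : R[i]) (b : bool).

Lemma pred_natr_neq0 : n%:R - 1 != 0 :> R[i].
Proof. by rewrite subr_eq0 -[1]/(1%:R) eqr_nat; case: n n2 => [|[]]. Qed.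

Definition pnum b z : R[i] := trig b ((n%:R + 1) * z / 2).
Definition qden b z : R[i] := trig b ((n%:R - 1) * z / 2).
Definition dqden b z : R[i] := dtrig b ((n%:R - 1) * z / 2).

Lemma arg_shift z : (n%:R + 1) * z / 2 = (n%:R - 1) * z / 2 + z.
Proof. by field. Qed.

Lemma pnumE b z : pnum b z = qden b z * ccos z + dqden b z * csin z.
Proof. by rewrite /pnum arg_shift trigD. Qed.

Lemma dpnumE b z : dtrig b ((n%:R + 1) * z / 2) = dqden b z * ccos z - qden b z * csin z.
Proof. by rewrite arg_shift dtrigD. Qed.

Lemma qdenN b z : qden b (- z) = tau R b * qden b z.
Proof. by rewrite /qden mulrN mulNr trigN. Qed.

Lemma qden_sqrD b z : qden b z ^+ 2 + dqden b z ^+ 2 = 1.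
Proof. exact: trig2Ddtrig2. Qed.

(** With p = S(A), q = S(B) and A - B = z, this is
    p^2 + q^2 - 2 cos (A - B) p q = sin^2 (A - B).  For rho = p / q, the left-hand
    side is q^2 (1 + rho^2 - 2 rho cos z) = q^2 kappa. *)
Lemma kappa_identity b z :
  qden b z ^+ 2 + pnum b z ^+ 2 - 2 * ccos z * pnum b z * qden b z = csin z ^+ 2.
Proof.
rewrite pnumE; have := qden_sqrD b z; have := ccos2Dcsin2 z.
move: (qden _ _) (dqden _ _) (ccos _) (csin _) => q d c s h1 h2.
transitivity (q ^+ 2 * (1 - c ^+ 2) + d ^+ 2 * s ^+ 2); first by ring.
have -> : 1 - c ^+ 2 = s ^+ 2 by rewrite -h1; ring.
by rewrite -mulrDl h2 mul1r.
Qed.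

(** The difference of squares S(B)^2 - S(A)^2 equals tau sin (A + B) sin (A - B),
    here with A + B = n z and A - B = z.  Divided by [kappa_identity], it gives
    lam = (1 - rho^2) / kappa = tau sin (n z) / sin z. *)
Lemma det_identity b z :
  qden b z ^+ 2 - pnum b z ^+ 2 = tau R b * csin (n%:R * z) * csin z.
Proof.
have -> : n%:R * z = ((n%:R - 1) * z / 2 + (n%:R - 1) * z / 2) + z by field.
rewrite csinD ccosD csinD pnumE /qden /dqden.
have := ccos2Dcsin2 z.
case: b; rewrite /trig /dtrig /tau; move: (csin _) (ccos _) (csin z) (ccos z) => S T s c h.
  transitivity (S ^+ 2 * (1 - c ^+ 2) - 2 * S * T * c * s - T ^+ 2 * s ^+ 2); first by ring.
  have -> : 1 - c ^+ 2 = s ^+ 2 by rewrite -h; ring.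
  by ring.
transitivity (T ^+ 2 * (1 - c ^+ 2) + 2 * S * T * c * s - S ^+ 2 * s ^+ 2); first by ring.
have -> : 1 - c ^+ 2 = s ^+ 2 by rewrite -h; ring.
by ring.
Qed.

Definition trig_seq b z (j : nat) : R[i] := trig b ((n%:R + 1 - 2 * j%:R) * z / 2).
(** Twice the derivative of [trig_seq] with respect to z. *)
Definition dtrig_seq b z (j : nat) : R[i] :=
  (n%:R + 1 - 2 * j%:R) * dtrig b ((n%:R + 1 - 2 * j%:R) * z / 2).

Lemma trig_seq0 b z : trig_seq b z 0 = pnum b z.
Proof. by rewrite /trig_seq mulr0 subr0. Qed.

Lemma trig_seq1 b z : trig_seq b z 1 = qden b z.
Proof. by rewrite /trig_seq mulr1 (_ : n%:R + 1 - 2 = n%:R - 1) //; ring. Qed.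

Lemma dtrig_seq0 b z : dtrig_seq b z 0 = (n%:R + 1) * dtrig b ((n%:R + 1) * z / 2).
Proof. by rewrite /dtrig_seq mulr0 subr0. Qed.

Lemma dtrig_seq1 b z : dtrig_seq b z 1 = (n%:R - 1) * dqden b z.
Proof. by rewrite /dtrig_seq mulr1 (_ : n%:R + 1 - 2 = n%:R - 1) //; ring. Qed.

Lemma arg_prev z (j : nat) : (n%:R + 1 - 2 * j%:R) * z / 2 =
  (n%:R + 1 - 2 * j.+1%:R) * z / 2 + z.
Proof. by rewrite -addn1 natrD; field. Qed.

Lemma arg_next z (j : nat) : (n%:R + 1 - 2 * j.+2%:R) * z / 2 =
  (n%:R + 1 - 2 * j.+1%:R) * z / 2 + - z.
Proof. by rewrite -addn1 natrD; field. Qed.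

Lemma trig_seq_rec b z j : trig_seq b z j + trig_seq b z j.+2 = 2 * ccos z * trig_seq b z j.+1.
Proof. by rewrite /trig_seq arg_prev arg_next !trigD ccosN csinN; ring. Qed.

(** Differentiating [trig_seq_rec] in z produces the further term
    - 2 sin z S((n - 1 - 2 j) z / 2), which vanishes here. *)
Lemma dtrig_seq_rec b z j : csin z = 0 ->
  dtrig_seq b z j + dtrig_seq b z j.+2 = 2 * ccos z * dtrig_seq b z j.+1.
Proof.
move=> s0; rewrite /dtrig_seq arg_prev arg_next !dtrigD ccosN csinN s0.
by rewrite -[j.+2]addn1 -[j.+1]addn1 !natrD; ring.
Qed.

Lemma arg_rev (j : nat) : (j <= n.+1)%N ->
  n%:R + 1 - 2 * (n.+1 - j)%:R = - (n%:R + 1 - 2 * j%:R) :> R[i].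
Proof. by move=> jn; rewrite natrB // -addn1 natrD; ring. Qed.

Lemma trig_seq_rev b z j : (j <= n.+1)%N -> trig_seq b z (n.+1 - j) = tau R b * trig_seq b z j.
Proof. by move=> jn; rewrite /trig_seq arg_rev // !mulNr trigN. Qed.

Lemma dtrig_seq_rev b z j : (j <= n.+1)%N -> dtrig_seq b z (n.+1 - j) = tau R b * dtrig_seq b z j.
Proof. by move=> jn; rewrite /dtrig_seq arg_rev // !mulNr dtrigN; ring. Qed.

Definition curve b : R[i] -> R[i] := quotient_ext (pnum b : C -> C) (qden b : C -> C).

Lemma continuous_pnum b : continuous (pnum b : C -> C).
Proof. exact: continuous_trig_scale. Qed.

Lemma continuous_qden b : continuous (qden b : C -> C).
Proof. exact: continuous_trig_scale. Qed.

Lemma curve_regular b (z : C) : qden b z != 0 ->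
  curve b z = pnum b z / qden b z /\ {for z, continuous (curve b : C -> C)}.
Proof.
move=> qz; apply: quotient_ext_regular qz.
  exact: continuous_pnum.
exact: continuous_qden.
Qed.

(** The zero 0 of sin is isolated: |Re ((w - z) / 2)| < 1 < pi. *)
Lemma csin_half_neq0 (z w : C) : ball z (1 : R[i]) w -> w != z -> csin ((w - z) / 2) != 0.
Proof.
move=> hb; apply: contra => /eqP e.
have hr : `|complex.Re (w - z)|%:C < 1.
  apply: le_lt_trans (normc_ge_Re _) _; move: hb; rewrite -ball_normE /= distrC.
  exact.
case eh : ((w - z) / 2) e => [x y] /csin_eq0[sx y0].
have e2 : w - z = (2 * x) +i* (2 * y).
  have -> : w - z = 2 * ((w - z) / 2) by field.
  by rewrite eh; apply/eqP; rewrite eq_complex /=; apply/andP; split; apply/eqP; ring.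
move: hr; rewrite e2 /= (_ : 1 = 1%:C) // ltcR ltr_norml => /andP[h1 h2].
have := @pi_ge2 R => p2.
have x0 : x = 0.
  case: (ltgtP x 0) => // hx.
    have : 0 < sin (- x) by apply: sin_gt0_pi; apply/andP; split; lra.
    by rewrite sinN sx oppr0 ltxx.
  have : 0 < sin x by apply: sin_gt0_pi; apply/andP; split; lra.
  by rewrite sx ltxx.
by rewrite -subr_eq0 e2 x0 y0 !mulr0.
Qed.

(** Both S((n + 1) w / 2) and S((n - 1) w / 2) vanish at z, so by the addition
    formula they are S'((n + 1) z / 2) sin ((n + 1) h) and
    S'((n - 1) z / 2) sin ((n - 1) h) with h = (w - z) / 2.  A factor sin h cancels
    from the two sines and leaves a quotient that is continuous at h = 0. *)
Lemma curve_singular b (z : C) : csin z = 0 -> qden b z = 0 ->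
  curve b z = ccos z * ((n%:R + 1) / (n%:R - 1)) /\ {for z, continuous (curve b : C -> C)}.
Proof.
move=> sz qz.
have pz : pnum b z = 0 by rewrite pnumE qz sz !(mul0r, mulr0) addr0.
have dq0 : dqden b z != 0.
  apply/eqP => d0; have := qden_sqrD b z; rewrite qz d0 expr0n addr0 => /eqP.
  by rewrite eq_sym oner_eq0.
have dpE : dtrig b ((n%:R + 1) * z / 2) = dqden b z * ccos z.
  by rewrite dpnumE qz mul0r subr0.
have n1E : n.-1%:R = n%:R - 1 :> R[i] by rewrite -subn1 natrB //; apply: ltnW.
have nS : n.+1%:R = n%:R + 1 :> R[i] by rewrite -addn1 natrD.
pose h (w : C) : C := ((w - z) * 2^-1 : R[i]).
pose den (w : C) : C := (dqden b z * csin_ratio n.-1 (h w) : R[i]).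
pose G (w : C) : C := ((dqden b z * ccos z) * csin_ratio n.+1 (h w) * (den w)^-1 : R[i]).
have hz : h z = 0 by rewrite /h subrr mul0r.
have hc : continuous h.
  move=> w; apply: (@continuous_forM _ (fun w => w - z) (fun=> 2^-1) w); last exact: continuous_for_cst.
  exact: continuous_forD (@continuous_for_id _ w) (@continuous_for_cst _ (- z) w).
have ratio_c m : continuous (fun w => csin_ratio m (h w) : C).
  by move=> w; apply: (@continuous_for_comp _ h (csin_ratio m)); [exact: hc|exact: continuous_csin_ratio].
have denc : continuous den 
  by move=> w; apply: (@continuous_forM _ (fun=> dqden b z) (fun w => csin_ratio n.-1 (h w)) w); [exact: continuous_for_cst|exact: ratio_c].
have denz : den z = dqden b z * (n%:R - 1) by rewrite /den hz csin_ratio0 n1E.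
have denz0 : den z != 0 by rewrite denz mulf_neq0 // pred_natr_neq0.
have Gc : {for z, continuous G}.
  apply: (@continuous_forM _ (fun w => dqden b z * ccos z * csin_ratio n.+1 (h w)) (fun w => (den w)^-1) z); last exact: (continuous_forV denz0 (denc z)).
  by apply: (@continuous_forM _ (fun=> dqden b z * ccos z) (fun w => csin_ratio n.+1 (h w)) z); [exact: continuous_for_cst|exact: ratio_c].
have Gz : G z = ccos z * ((n%:R + 1) / (n%:R - 1)).
  rewrite /G denz hz csin_ratio0 nS; have := pred_natr_neq0; move: dq0.
  by move: (dqden _ _) (ccos _) => d c d0 m0; field; apply/andP.
have pw w : pnum b w = dqden b z * ccos z * csin_ratio n.+1 (h w) * csin (h w).
  rewrite /pnum (_ : (n%:R + 1) * w / 2 = (n%:R + 1) * z / 2 + n.+1%:R * h w).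
    by rewrite trigD -/(pnum b z) pz mul0r add0r dpE csin_ratioE mulrA.
  by rewrite nS /h; field.
have qw w : qden b w = den w * csin (h w).
  rewrite /qden (_ : (n%:R - 1) * w / 2 = (n%:R - 1) * z / 2 + n.-1%:R * h w).
    by rewrite trigD -/(qden b z) qz mul0r add0r csin_ratioE mulrA.
  by rewrite n1E /h; field.
rewrite -Gz; apply: quotient_ext_singular => //.
have H1 : nbhs z (fun w => den w != 0) := @cvgr_neq0 _ _ _ _ (nbhs_filter z) _ _ (denc z) denz0.
have H2 : nbhs z (ball z (1 : R[i])) by apply: nbhsx_ballx; exact: ltr01.
apply: (@filterS2 _ _ (nbhs_filter z) _ _ _ _ H1 H2) => w d0 bw wz.
have s0 := csin_half_neq0 bw wz.
rewrite pw qw; split; first by rewrite mulf_neq0.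
rewrite /G; move: d0 s0; rewrite -/(h w).
move: (den w) (csin (h w)) (dqden b z * ccos z * _) => d s a d0 s0.
by field; apply/andP.
Qed.

Lemma curve_real b (z : C) : csin z = 0 ->
  curve b z = ccos z * (if qden b z == 0 then (n%:R + 1) / (n%:R - 1) else 1).
Proof.
move=> sz; case: ifPn => [/eqP|] qz; first by have [] := curve_singular sz qz.
have [-> _] := curve_regular qz.
by rewrite pnumE sz mulr0 addr0 mulr1 mulrAC divff // mul1r.
Qed.

Lemma csin_mu_eq0 u : sin u = 0 -> csin (mu n u) = 0 :> R[i].
Proof. by move=> su; rewrite /mu sin0_v // complexr0 csin_real su. Qed.

(** A zero of the denominator is real, so v(n, u) = 0, which forces sin u = 0. *)
Lemma qden_mu_eq0 b u : qden b (mu n u) = 0 -> csin (mu n u) = 0 :> R[i].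
Proof.
have e : (n%:R - 1) * mu n u / 2 = ((n%:R - 1) * u / 2) +i* ((n%:R - 1) * v n u / 2) :> R[i].
  have -> : n%:R - 1 = ((n%:R - 1 : R) %:C) :> R[i] by rewrite rmorphB rmorph_nat.
  have -> : 2^-1 = ((2^-1 : R) %:C) :> R[i] by rewrite fmorphV rmorph_nat.
  by rewrite /mu; apply/eqP; rewrite eq_complex /=; apply/andP; split; apply/eqP; ring.
rewrite /qden e => /trig_eq0_Im/eqP; rewrite !mulf_eq0 invr_eq0 pnatr_eq0 orbF.
rewrite subr_eq0 -[1]/(1%:R) eqr_nat => /orP[/eqP n1|/eqP/(v_eq0_sin n2)/csin_mu_eq0//].
by move: n2; rewrite n1.
Qed.

Lemma continuous_mu : continuous (fun u : R => mu n u : C).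
Proof.
move=> u; apply: (@cvg_complex _ _ _ (nbhs_filter u) id (v n)); first exact: cvg_id.
exact: continuous_v.
Qed.

Lemma continuous_curve_mu b : continuous (fun u : R => curve b (mu n u) : C).
Proof.
move=> u; apply: (@continuous_comp _ _ _ (fun u : R => mu n u : C) (curve b : C -> C)).
  exact: continuous_mu.
have [q0|q0] := eqVneq (qden b (mu n u)) 0; last by have [] := curve_regular q0.
by have [] := curve_singular (qden_mu_eq0 q0) q0.
Qed.

(** The end points are mu(n, -pi) = - pi and mu(n, pi) = pi; cos is even and the
    denominator has a parity, so [curve_real] gives the same value at both. *)
Lemma closed_curve_mu b : closed_curve (fun u : R => curve b (mu n u) : C).
Proof.
split; first by apply: continuous_subspaceT; exact: continuous_curve_mu.
have sNpi : sin (- pi) = 0 :> R by rewrite sinN sinpi oppr0.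
rewrite !curve_real; try by apply: csin_mu_eq0; rewrite ?sNpi ?sinpi.
rewrite /mu !sin0_v ?sinpi // !complexr0 !ccos_real cosN; rewrite rmorphN qdenN mulf_eq0.
have /negbTE -> // : tau R b != 0 by rewrite -normr_eq0 norm_tau oner_eq0.
Qed.
End Curve.

(** * Borderline eigenvalues and the curves *)

Section Equivalence.
Variable R : realType.
Variable n : nat.
Hypothesis n2 : (2 <= n)%N.
Implicit Types (z rho lam : R[i]) (b : bool).

Definition parity_vec b (y : 'cV[R[i]]_n) : Prop :=
  forall j, y (rev_ord j) 0 = tau R b * y j 0.

Definition borderline_parity b rho : Prop := exists lam : R[i], `|lam| = n%:R /\
  exists y, parity_vec b y /\ eigenvector (KMS n rho) lam y.

(** The equation defining v(n, x) is |sin (n z)| = n |sin z| for z = x + i v(n, x). *)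
Lemma sqr_norm_csin_nat (x y : R) :
  `|csin (n%:R * (x +i* y))| ^+ 2 - n%:R ^+ 2 * `|csin (x +i* y)| ^+ 2 = (phi n y - g n x)%:C.
Proof.
have -> : n%:R * (x +i* y) = (n%:R * x) +i* (n%:R * y).
  have -> : n%:R = (n%:R : R)%:C by rewrite rmorph_nat.
  by apply/eqP; rewrite eq_complex /=; apply/andP; split; apply/eqP; ring.
rewrite !sqr_norm_csin.
have -> : n%:R = (n%:R : R)%:C by rewrite rmorph_nat.
by rewrite -rmorphXn -rmorphM -rmorphB /phi /g; congr _%:C; ring.
Qed.

Lemma sqr_norm_csin_mu (u : R) : `|csin (n%:R * mu n u)| ^+ 2 = n%:R ^+ 2 * `|csin (mu n u)| ^+ 2.
Proof.
apply/eqP; rewrite -subr_eq0 sqr_norm_csin_nat.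
by have [_ ->] := v_spec n2 u; rewrite subrr.
Qed.

Lemma mu_eq (x y : R) : 0 <= y ->
  `|csin (n%:R * (x +i* y))| ^+ 2 = n%:R ^+ 2 * `|csin (x +i* y)| ^+ 2 -> mu n x = x +i* y.
Proof.
move=> y0 /eqP; rewrite -subr_eq0 sqr_norm_csin_nat => /eqP/complexI/eqP.
by rewrite subr_eq0 /mu => /eqP/(v_uniq n2 y0) ->.
Qed.

Lemma borderline_of_seq b rho lam kappa (s : nat -> R[i]) :
  `|lam| = n%:R -> kappa != 0 -> lam * kappa = 1 - rho ^+ 2 ->
  s 1%N != 0 -> s 0%N = rho * s 1%N ->
  (forall j, (j <= n.+1)%N -> s (n.+1 - j)%N = tau R b * s j) ->
  (forall j, rho * (s j + s j.+2) = (1 + rho ^+ 2 - kappa) * s j.+1) ->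
  borderline_parity b rho.
Proof.
move=> nl k0 hk s1 s0 rs hs; exists lam; split => //.
apply: (@eigenvector_of_seq _ _ _ _ _ s); rewrite ?(ltnW n2) // => j jn.
apply: (mulfI k0); rewrite (@ksum_telescope _ _ _ kappa) //.
- by rewrite -hk mulrA [kappa * _]mulrC.
- have e : s n = tau R b * s 1%N by rewrite -rs ?subSS ?subn0.
  by have := rs _ (leq0n n.+1); rewrite subn0 s0 e => ->; ring.
Qed.

Lemma norm_eq_nat (lam : R[i]) : `|lam| ^+ 2 = n%:R ^+ 2 -> `|lam| = n%:R.
Proof. by move/eqP; rewrite eqrXn2 // => /eqP. Qed.

(** The eigenvector is the trigonometric sequence when the denominator is not 0, and
    its derivative otherwise. *)
Lemma curve_borderline_parity b (u : R) : borderline_parity b (curve n b (mu n u)).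
Proof.
set z := mu n u; pose rho : R[i] := curve n b z; change (borderline_parity b rho).
have [sz|sz] := eqVneq (csin z) 0.
  have e2 : ccos z ^+ 2 = 1 by rewrite -(ccos2Dcsin2 z) sz expr0n addr0.
  have rE : rho = _ := curve_real n2 b sz.
  have p0 : pnum n b z = qden n b z * ccos z by rewrite pnumE sz mulr0 addr0.
  case: ifPn rE => [/eqP qz|qz] rE.
    have n1 := pred_natr_neq0 R n2.
    (* rho = cos z * r with cos z = 1 or -1, so kappa = (1 - r)^2, and
       1 + r = - n (1 - r) gives lam = - n. *)
    pose r : R[i] := (n%:R + 1) / (n%:R - 1).
    have hr : 1 - r = - 2 / (n%:R - 1) by rewrite /r; field.
    have r2 : rho ^+ 2 = r ^+ 2 by rewrite rE exprMn e2 mul1r.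
    have er : ccos z * rho = r by rewrite rE mulrA -expr2 e2 mul1r.
    apply: (@borderline_of_seq _ _ (- n%:R) ((1 - r) ^+ 2) (dtrig_seq n b z)).
    - by rewrite normrN normr_nat.
    - by rewrite expf_neq0 // hr mulf_neq0 ?invr_eq0 // oppr_eq0 pnatr_eq0.
    - by rewrite r2 /r; field.
    - rewrite dtrig_seq1 mulf_neq0 //; apply/eqP => d0; have := qden_sqrD n b z.
      by rewrite qz d0 expr0n addr0 => /eqP; rewrite eq_sym oner_eq0.
    - rewrite dtrig_seq0 dtrig_seq1 dpnumE qz mul0r subr0 rE.
      by move: (dqden _ _ _) => d; field.
    - by move=> j; exact: dtrig_seq_rev.
    - move=> j; rewrite dtrig_seq_rec //.
      transitivity (2 * (ccos z * rho) * dtrig_seq n b z j.+1); first by ring.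
      by rewrite er r2; ring.
  rewrite mulr1 in rE.
  exists n%:R; split; first by rewrite normr_nat.
  apply: (@eigenvector_of_seq _ _ _ _ _ (trig_seq n b z)).
  - exact: ltnW.
  - by rewrite trig_seq1.
  - by move=> j; exact: trig_seq_rev.
  - move=> j jn; apply: ksum_rank1; rewrite ?rE //.
      by rewrite trig_seq0 trig_seq1 p0 mulrC.
    by move=> k _; exact: trig_seq_rec.
have q0 : qden n b z != 0 by apply: contra sz => /eqP/(qden_mu_eq0 n2) ->.
have rE : rho = _ := (curve_regular q0).1.
have rq : rho * qden n b z = pnum n b z by rewrite rE divfK.
pose kappa := 1 + rho ^+ 2 - 2 * ccos z * rho.
have kE : kappa * qden n b z ^+ 2 = csin z ^+ 2.
  by rewrite -(kappa_identity n b) -rq /kappa; ring.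
have k0 : kappa != 0.
  by apply: contra sz => /eqP k0; rewrite -sqrf_eq0 -kE k0 mul0r.
have dE : (1 - rho ^+ 2) * qden n b z ^+ 2 = tau R b * csin (n%:R * z) * csin z.
  by rewrite -det_identity -rq; ring.
pose lam := tau R b * csin (n%:R * z) / csin z.
apply: (@borderline_of_seq _ _ lam kappa (trig_seq n b z)) => //.
- apply: norm_eq_nat; rewrite /lam normrM normfV normrM norm_tau mul1r.
  rewrite expr_div_n sqr_norm_csin_mu mulfK //.
  by rewrite expf_neq0 // normr_eq0.
- apply: (@mulIf _ (qden n b z ^+ 2)); first by rewrite expf_neq0.
  by rewrite -mulrA kE dE /lam; field.
- by rewrite trig_seq1.
- by rewrite trig_seq0 trig_seq1 rq.
- by move=> j; exact: trig_seq_rev.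
- by move=> j; rewrite trig_seq_rec /kappa; ring.
Qed.

(** rho = 0 is impossible since K_n(0) is the identity, whose only eigenvalue is 1.
    Hence c = (1 + rho^2 - kappa) / (2 rho) is defined, and z is chosen with
    cos z = c. *)
Lemma borderline_parity_curve b rho : borderline_parity b rho ->
  exists2 u : R, u \in `[- pi, pi] & rho = curve n b (mu n u).
Proof.
move=> [lam [nl [y [ry [y0 Ky]]]]].
have n0 : n%:R != 0 :> R[i] by rewrite pnatr_eq0; case: n n2.
have lam0 : lam != 0 by rewrite -normr_eq0 nl.
have rho0 : rho != 0.
  apply/eqP => r0; move: Ky.
  have -> : KMS n rho = 1%:M.
    apply/matrixP => i j; rewrite !mxE r0 expr0n; congr (_%:R).
    by rewrite absz_eq0 subr_eq0 eqz_nat.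
  rewrite mul1mx => e.
  have /eqP : (1 - lam) *: y = 0 by rewrite scalerBl scale1r -e subrr.
  rewrite scaler_eq0 (negbTE y0) orbF subr_eq0 => /eqP l1.
  move: nl; rewrite -l1 normr1 -[1]/(1%:R) => /eqP; rewrite eqr_nat => /eqP n1.
  by move: n2; rewrite -n1.
pose kappa := (1 - rho ^+ 2) / lam.
have lk : lam * kappa = 1 - rho ^+ 2 by rewrite /kappa mulrC divfK.
have [x [v0 [hc hx hv]]] := ccos_surj ((1 + rho ^+ 2 - kappa) / (2 * rho)).
set z := x +i* v0 in hc.
have kc : 2 * rho * ccos z = 1 + rho ^+ 2 - kappa.
  by rewrite hc mulrC divfK // mulf_neq0 // pnatr_eq0.
have fwd s := @eigenvector_secular R n rho lam kappa (tau R b) y s (tau_sq R b) n2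
   rho0 lam0 lk (conj y0 Ky) ry.
have rq : rho * qden n b z = pnum n b z.
  rewrite -trig_seq0 -trig_seq1; apply: fwd => j jn.
    by rewrite trig_seq_rec -kc; ring.
  by apply: trig_seq_rev; case/andP: jn => _ /leqW.
exists x; first by rewrite in_itv.
have [sz|sz] := eqVneq (csin z) 0.
  have [sx v00] := csin_eq0 sz.
  have -> : mu n x = z by rewrite /mu sin0_v // /z v00.
  have [qz|qz] := eqVneq (qden n b z) 0; last first.
    by have [-> _] := curve_regular qz; rewrite -rq mulfK.
  have [-> _] := curve_singular n2 sz qz.
  have : rho * dtrig_seq n b z 1 = dtrig_seq n b z 0.
    apply: fwd => j jn; first by rewrite dtrig_seq_rec // -kc; ring.
    by apply: dtrig_seq_rev; case/andP: jn => _ /leqW.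
  rewrite dtrig_seq0 dtrig_seq1 dpnumE qz mul0r subr0 => e.
  have d0 : dqden n b z != 0.
    apply/eqP => d0; have := qden_sqrD n b z; rewrite qz d0 expr0n addr0 => /eqP.
    by rewrite eq_sym oner_eq0.
  have n1 := pred_natr_neq0 R n2.
  apply: (@mulIf _ ((n%:R - 1) * dqden n b z)); first by rewrite mulf_neq0.
  by rewrite e; field.
have qz : qden n b z != 0.
  apply: contra sz => /eqP q0; have := kappa_identity n b z.
  by rewrite -rq q0 => /esym; rewrite -sqrf_eq0 => ->; apply/eqP; ring.
have kE : kappa * qden n b z ^+ 2 = csin z ^+ 2.
  have -> : kappa = 1 + rho ^+ 2 - 2 * rho * ccos z by rewrite kc; ring.
  by rewrite -(kappa_identity n b) -rq; ring.
have ls : lam * csin z = tau R b * csin (n%:R * z).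
  have dE : (1 - rho ^+ 2) * qden n b z ^+ 2 = tau R b * csin (n%:R * z) * csin z.
    by rewrite -det_identity -rq; ring.
  by apply: (mulIf sz); rewrite -dE -lk -mulrA -expr2 -kE mulrA.
have -> : mu n x = z.
  apply: mu_eq => //; rewrite -/z.
  have : `|lam * csin z| = `|csin (n%:R * z)| by rewrite ls normrM norm_tau mul1r.
  by move=> <-; rewrite normrM nl exprMn.
by have [-> _] := curve_regular qz; rewrite -rq mulfK.
Qed.

Lemma borderline_iff b rho (P : 'cV[R[i]]_n -> Prop) :
  (forall y, P y <-> parity_vec b y) ->
  (exists lam : R[i], borderline_eigenvalue n rho lam /\
     (eigenvalue (KMS n rho) lam /\ exists y, P y /\ eigenvector (KMS n rho) lam y)) <->
  exists2 u : R, u \in `[- pi, pi] & rho = curve n b (mu n u).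
Proof.
move=> hP; split.
  move=> [lam [[_ nl] [_ [y [Py ey]]]]]; apply: borderline_parity_curve; exists lam; split => //.
  by exists y; split => //; apply/hP.
move=> [u _ ->]; have [lam [nl [y [py ey]]]] := curve_borderline_parity b u.
have ev := eigenvector_eigenvalue ey.
by exists lam; do 2!split => //; exists y; split => //; apply/hP.
Qed.

End Equivalence.

Theorem corollary4p3 (R : realType) (n : nat) (hn : (2 <= n)%N) :
  (closed_curve (f1 (R := R) n) /\ closed_curve (f2 (R := R) n)) /\
  (forall rho : R[i],
     (exists lam : R[i],
        borderline_eigenvalue n rho lam /\ type1_eigenvalue n rho lam)
     <-> B1 n rho) /\
  (forall rho : R[i],
     (exists lam : R[i],
        borderline_eigenvalue n rho lam /\ type2_eigenvalue n rho lam)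
     <-> B2 n rho).
Proof.
split; [split|split].
- change (closed_curve (fun u : R => curve n true (mu n u) : R[i]^o)).
  exact: closed_curve_mu.
- change (closed_curve (fun u : R => curve n false (mu n u) : R[i]^o)).
  exact: closed_curve_mu.
- move=> rho; apply: (@borderline_iff _ _ hn true rho (@skew_symmetric_vec R n)) => y.
  by split=> h j; rewrite h /tau mulN1r.
- move=> rho; apply: (@borderline_iff _ _ hn false rho (@symmetric_vec R n)) => y.
  by split=> h j; rewrite h /tau mul1r.
Qed.
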